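(* Let $\mathcal{H}$ be a complex Hilbert space and let $A,B\in \mathcal{B}(\mathcal{H})$. Then, for either choice of the sign $\pm$, $$w(AB\pm BA)\leq 2\sqrt{2}\,\|B\|\left(w^4(A)-\frac{1}{4}c\left(\left(\Re(A^2)\right)^2\right)-\frac{\big|\,\|\Re(A)\|^4-\|\Im(A)\|^4\,\big|}{2}\right)^{\frac{1}{4}}$$ and $$2\sqrt{2}\,\|B\|\left(w^4(A)-\frac{1}{4}c\left(\left(\Re(A^2)\right)^2\right)-\frac{\big|\,\|\Re(A)\|^4-\|\Im(A)\|^4\,\big|}{2}\right)^{\frac{1}{4}}\leq 2\sqrt{2}\,\|B\|\left(w^4(A)-\frac{\big|\,\|\Re(A)\|^4-\|\Im(A)\|^4\,\big|}{2}\right)^{\frac{1}{4}}.$$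
   Context: $\mathcal{B}(\mathcal{H})$ denotes the algebra of all bounded linear operators on the complex Hilbert space $\mathcal{H}$, with operator norm $\|\cdot\|$ and adjoint $A^*$. The numerical radius is $w(A)=\sup\{|\langle Ax,x\rangle| : x\in\mathcal{H},\ \|x\|=1\}$, with $w^4(A)=(w(A))^4$, and the Crawford number is $c(A)=\inf\{|\langle Ax,x\rangle| : x\in\mathcal{H},\ \|x\|=1\}$. For $T\in\mathcal{B}(\mathcal{H})$, the real and imaginary parts are the operators $\Re(T)=\frac{T+T^*}{2}$ and $\Im(T)=\frac{T-T^*}{2\mathrm{i}}$. *)

(* Defs.v *)
From HB Require Import structures.
From mathcomp Require Import all_boot all_order all_algebra.
From mathcomp Require Import all_classical all_reals all_analysis.
From mathcomp.real_closed Require Export complex.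

Set Implicit Arguments.
Unset Strict Implicit.
Unset Printing Implicit Defensive.

Import Order.TTheory GRing.Theory Num.Theory.
Import numFieldNormedType.Exports.

Local Open Scope classical_set_scope.
Local Open Scope ring_scope.
Local Open Scope complex_scope.

(* [{dot H for Num.conj}] is a positive definite form, linear in its first
   argument and conjugate-linear in the second. *)
Record hilbertSpace (R : realType) := HilbertSpace {
  hilbert_sort :> completeNormedModType R[i];
  inner : {dot hilbert_sort for @Num.conj R[i]};
  inner_normE : forall x : hilbert_sort, `|x| ^+ 2 = inner x x }.

(* Norms over R[i] take their values in R[i]; they are real there, and
   [rnorm] reads them in R, where sup and inf are available. *)
Definition rnorm (R : realType) (V : normedZmodType R[i]) (x : V) : R :=
  complex.Re `|x|.

Section Operators.
Variables (R : realType) (H : hilbertSpace R).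
Implicit Types f : H -> H.

Definition bounded_operator f := exists M : R, forall x, rnorm (f x) <= M * rnorm x.

Definition opnorm f : R := sup [set rnorm (f x) | x in [set x : H | rnorm x <= 1]].

(* On the zero space both sets below are empty, and sup and inf are then 0. *)
Definition numerical_radius f : R :=
  sup [set rnorm (inner H (f x) x : R[i]) | x in [set x : H | rnorm x = 1]].

Definition crawford f : R :=
  inf [set rnorm (inner H (f x) x : R[i]) | x in [set x : H | rnorm x = 1]].

(* The adjoint, unique when it exists; it exists for every bounded linear
   operator by the Riesz representation theorem. *)
Definition adjoint f : H -> H :=
  xget (fun=> 0) [set g : H -> H | forall x y, inner H (f x) y = inner H x (g y)].

Definition re_op f : H -> H := fun x => 2^-1 *: (f x + adjoint f x).

Definition im_op f : H -> H := fun x => (2 * 'i)^-1 *: (f x - adjoint f x).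

End Operators.

(* Main.v *)
Require Import Defs.
From mathcomp Require Import all_boot all_order all_algebra.
From mathcomp Require Import all_classical all_reals all_analysis.
From mathcomp Require Import lra ring.

(* With a = Re A and b = Im A, Cauchy-Schwarz on a unit vector x gives
   |<(AB +- BA)x, x>| <= |B| (|Ax| + |A* x|), and the parallelogram law gives
   |Ax|^2 + |A* x|^2 = 2 s with s = |ax|^2 + |bx|^2, so that the left-hand side
   is at most 2 |B| sqrt s.  Since Re(A^2) = a^2 - b^2 and s = <(a^2 + b^2)x, x>,
   the parallelogram law for a^2 x and b^2 x gives
   s^2 + c(Re(A^2)^2) <= 2 (|a|^4 + |b|^4).  Both |a| and |b| are at most w(A)
   by polarization, hence 2 (|a|^4 + |b|^4) <= 4 w(A)^4 - 2 ||a|^4 - |b|^4|. *)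

Set Implicit Arguments.
Unset Strict Implicit.
Unset Printing Implicit Defensive.

Import Order.TTheory GRing.Theory Num.Theory.
Import numFieldNormedType.Exports.

Local Open Scope ring_scope.

(** * Norms with values in [R[i]], read as real numbers *)

Section RealNorm.
Local Open Scope complex_scope.
Variables (R : realType) (V : normedZmodType R[i]).
Implicit Types x y : V.

Lemma rnormE x : (rnorm x)%:C = `|x|.
Proof. by rewrite /rnorm RRe_real ?normr_real. Qed.

Lemma rnorm_ge0 x : 0 <= rnorm x.
Proof. by rewrite -ler0c rnormE. Qed.

Lemma rnorm0 : rnorm (0 : V) = 0.
Proof. by rewrite /rnorm normr0. Qed.

Lemma rnorm_eq0 x : rnorm x = 0 -> x = 0.
Proof. by move=> x0; apply/eqP; rewrite -normr_eq0 -rnormE x0. Qed.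

Lemma rnorm_gt0 x : x != 0 -> 0 < rnorm x.
Proof.
by move=> x0; rewrite lt_def rnorm_ge0 andbT; apply: contra_neq x0 => /rnorm_eq0.
Qed.

Lemma rnormD x y : rnorm (x + y) <= rnorm x + rnorm y.
Proof. by rewrite -lecR rmorphD /= !rnormE ler_normD. Qed.

Lemma rnormN x : rnorm (- x) = rnorm x.
Proof. by rewrite /rnorm normrN. Qed.

End RealNorm.

(** * Moduli, real parts and phases of complex numbers *)

Section ComplexNorm.
Local Open Scope complex_scope.
Variable R : realType.
Implicit Type z : R[i].

Lemma rnormM z z' : rnorm (z * z') = rnorm z * rnorm z'.
Proof.
have : (rnorm (z * z'))%:C = (rnorm z)%:C * (rnorm z')%:C.
  by rewrite !rnormE normrM.
by rewrite -rmorphM => /complexI.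
Qed.

Lemma rnormZ (V : normedModType R[i]) z (x : V) :
  rnorm (z *: x) = rnorm z * rnorm x.
Proof.
by apply: complexI; rewrite rnormE normrZ rmorphM /= !rnormE.
Qed.

Lemma rnorm_real (t : R) : rnorm t%:C = `|t|.
Proof. by rewrite /rnorm normc_def /= expr0n /= addr0 sqrtr_sqr. Qed.

Lemma rnormi : @rnorm R R[i] 'i%R = 1.
Proof. by rewrite /rnorm normCi. Qed.

Lemma Re_le_rnorm z : complex.Re z <= rnorm z.
Proof.
by rewrite -lecR rnormE (le_trans _ (normc_ge_Re z)) // lecR ler_norm.
Qed.

(** Multiplying by a phase turns a modulus into a real part, so estimates of real parts pass to
    moduli. *)
Lemma rnorm_phase z : exists2 u : R[i], rnorm u = 1 & complex.Re (u * z) = rnorm z.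
Proof.
have [->|z0] := eqVneq z 0.
  by exists 1; rewrite ?mulr0 /rnorm ?normr1 ?normr0.
exists (`|z| / z); last by rewrite divfK.
by rewrite /rnorm normrM normrV ?unitfE // normr_id divff ?normr_eq0.
Qed.

Lemma ReM_real (t : R) z : complex.Re (t%:C * z) = t * complex.Re z.
Proof. by case: z => u v /=; rewrite mul0r subr0. Qed.

End ComplexNorm.

(** * The real inner product, Cauchy-Schwarz, the parallelogram law, completeness *)

Section RealInner.
Local Open Scope complex_scope.
Variables (R : realType) (H : hilbertSpace R).
Implicit Types (x y z h : H) (t : R).

Lemma innerDl x y z : inner H (x + y) z = inner H x z + inner H y z.
Proof. exact: linearDl. Qed.

Lemma innerDr x y z : inner H x (y + z) = inner H x y + inner H x z.
Proof. exact: linearDr. Qed.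

Lemma innerZl (a : R[i]) x y : inner H (a *: x) y = a * inner H x y.
Proof. exact: linearZl_LR. Qed.

Lemma innerZr (a : R[i]) x y : inner H x (a *: y) = Num.conj a * inner H x y.
Proof. exact: linearZr_LR. Qed.

Lemma innerC x y : inner H x y = Num.conj (inner H y x).
Proof. by rewrite hermC expr0 mul1r. Qed.

Lemma inner0l x : inner H 0 x = 0.
Proof. exact: linear0l. Qed.

Lemma innerNl x y : inner H (- x) y = - inner H x y.
Proof. exact: linearNl. Qed.

(** The inner product of [H] seen as a real space: symmetric and valued in the ordered field [R], so
    that expanded squares are within reach of [lra] and [nra]. *)
Definition rdot x y : R := complex.Re (inner H x y).

Lemma rdotC x y : rdot x y = rdot y x.
Proof.
rewrite /rdot innerC.
by apply: complexI; rewrite !complexRe Re_conj.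
Qed.

Lemma rdotDl x y z : rdot (x + y) z = rdot x z + rdot y z.
Proof. by rewrite /rdot innerDl raddfD. Qed.

Lemma rdotDr x y z : rdot z (x + y) = rdot z x + rdot z y.
Proof. by rewrite !(rdotC z) rdotDl. Qed.

Lemma rdotZl t x y : rdot (t%:C *: x) y = t * rdot x y.
Proof. by rewrite /rdot innerZl ReM_real. Qed.

Lemma rdotZr t x y : rdot x (t%:C *: y) = t * rdot x y.
Proof. by rewrite !(rdotC x) rdotZl. Qed.

Lemma rdotNl x y : rdot (- x) y = - rdot x y.
Proof. by rewrite -scaleN1r -[-1](rmorphN1 (real_complex R)) rdotZl mulN1r. Qed.

Lemma rdotNr x y : rdot x (- y) = - rdot x y.
Proof. by rewrite !(rdotC x) rdotNl. Qed.

Lemma rdotBl x y z : rdot (x - y) z = rdot x z - rdot y z.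
Proof. by rewrite rdotDl rdotNl. Qed.

Lemma rdotBr x y z : rdot z (x - y) = rdot z x - rdot z y.
Proof. by rewrite rdotDr rdotNr. Qed.

Lemma rdotxx x : rdot x x = rnorm x ^+ 2.
Proof.
by rewrite /rdot -inner_normE -rnormE -rmorphXn.
Qed.

Lemma rdot0l x : rdot 0 x = 0.
Proof. by rewrite /rdot inner0l. Qed.

Lemma rdot_le x y : rdot x y <= rnorm x * rnorm y.
Proof.
have [->|x0] := eqVneq x 0; first by rewrite rdot0l mulr_ge0 ?rnorm_ge0.
have [->|y0] := eqVneq y 0; first by rewrite rdotC rdot0l mulr_ge0 ?rnorm_ge0.
have px := rnorm_gt0 x0; have py := rnorm_gt0 y0.
(* The two scaled vectors have equal length; expanding gives [2 * a * b * (a * b - r) >= 0], and the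
   positive factor [a * b] cancels. *)
have := sqr_ge0 (rnorm ((rnorm y)%:C *: x - (rnorm x)%:C *: y)).
rewrite -rdotxx !(rdotBl, rdotBr, rdotZl, rdotZr) !rdotxx (rdotC y x).
set a := rnorm x in px *; set b := rnorm y in py *; set r := rdot x y => h.
have ab : 0 < a * b by rewrite mulr_gt0.
rewrite -(ler_pM2l ab); nra.
Qed.

Lemma norm_rdot_le x y : `|rdot x y| <= rnorm x * rnorm y.
Proof.
have := rdot_le (- x) y; have := rdot_le x y.
rewrite rdotNl {3}/rnorm normrN -/(rnorm x) ler_norml; lra.
Qed.

(** A phase absorbed into [x] makes the inner product real without changing the norm of [x], so the
    real Cauchy-Schwarz inequality suffices. *)
Lemma rnorm_inner_le x y : rnorm (inner H x y) <= rnorm x * rnorm y.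
Proof.
have [u u1 <-] := rnorm_phase (inner H x y).
rewrite -innerZl; apply: le_trans (rdot_le (u *: x) y) _.
by rewrite rnormZ u1 mul1r.
Qed.

Lemma rnorm_inner_self x : rnorm (inner H x x) = rnorm x ^+ 2.
Proof.
by rewrite -inner_normE -rnormE -rmorphXn rnorm_real ger0_norm ?sqr_ge0.
Qed.

Lemma parallelogram x y :
  rnorm (x + y) ^+ 2 + rnorm (x - y) ^+ 2 = 2 * (rnorm x ^+ 2 + rnorm y ^+ 2).
Proof.
by rewrite -!rdotxx !(rdotBl, rdotBr, rdotDl, rdotDr) (rdotC y x); ring.
Qed.

Lemma inner_ext x y : (forall h, inner H h x = inner H h y) -> x = y.
Proof.
move=> e; apply/eqP; rewrite -subr_eq0; apply/eqP/rnorm_eq0/eqP.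
rewrite -sqrf_eq0 -rdotxx rdotBr; apply/eqP.
by rewrite /rdot e subrr.
Qed.

Lemma hilbert_complete (x : nat -> H) :
  (forall e : R, 0 < e -> exists N, forall m n, (N <= m)%N -> (N <= n)%N ->
    rnorm (x m - x n) < e) ->
  exists z, forall e : R, 0 < e -> exists N, forall n, (N <= n)%N ->
    rnorm (z - x n) < e.
Proof.
move=> xC.
have cv : cvgn x.
  apply/cauchy_cvgP/cauchy_ballP => e e0.
  (* A positive element of [R[i]] is real, so the complex radius of the ball can be read in [R]. *)
  have eE : e = (complex.Re e)%:C by rewrite RRe_real ?gtr0_real.
  have Re0 : 0 < complex.Re e by rewrite -ltcR -eE.
  have [N hN] := xC _ Re0.
  near_simpl; near=> m n; rewrite -ball_normE /ball_ /= eE -rnormE ltcR.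
  by apply: hN; [near: m | near: n]; exists N.
exists (limn x) => e e0.
have /cvgrPdist_lt /(_ e%:C) : (x @ \oo --> limn x)%classic by [].
rewrite ltcR => /(_ e0) [N _ hN]; exists N => n Nn.
by rewrite -ltcR rnormE; apply: hN.
Unshelve. all: by end_near.
Qed.

End RealInner.

(** * The Riesz representation theorem and existence of the adjoint *)

Section Riesz.
Local Open Scope complex_scope.
Variables (R : realType) (H : hilbertSpace R).
Implicit Types (x y z h : H).

Section RealRiesz.
Variables (p : H -> R) (C : R).
Hypothesis pD : forall x y, p (x + y) = p x + p y.
Hypothesis pZ : forall t x, p (t%:C *: x) = t * p x.
Hypothesis pC : forall x, p x <= C * rnorm x.

(* The minimizer of [J] represents [p]. *)
Let J x := rnorm x ^+ 2 - 2 * p x.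
Let J_lb x : - C ^+ 2 <= J x.
Proof. by have := pC x; rewrite /J; have := sqr_ge0 (rnorm x - C); nra. Qed.

Let mu := inf (range J).

Let mu_le x : mu <= J x.
Proof.
apply: ge_inf; last by exists x.
by exists (- C ^+ 2) => _ [y _ <-]; apply: J_lb.
Qed.

Let mu_approx e : 0 < e -> exists x, J x < mu + e.
Proof.
move=> e0; have hi : has_inf (range J).
  by split; [exists (J 0), 0|exists (- C ^+ 2) => _ [y _ <-]; apply: J_lb].
by have [_ [x _ <-] hx] := inf_adherent e0 hi; exists x.
Qed.

(** Moving from [x] along [h] can lower the quadratic [J] by at most [e], so its derivative in that
    direction is small. *)
Let almost_min_residual x e h : J x <= mu + e ->
  (rdot x h - p h) ^+ 2 <= e * rnorm h ^+ 2.
Proof.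
move=> hx; have [->|h0] := eqVneq h 0.
  have -> : p 0 = 0.
    by rewrite -(scale0r (0 : H)) -[0](rmorph0 (real_complex R)) pZ mul0r.
  by rewrite rdotC rdot0l rnorm0 subrr !expr0n mulr0.
have ph : 0 < rnorm h ^+ 2 by rewrite exprn_gt0 ?rnorm_gt0.
set q := rdot x h - p h; set N := rnorm h ^+ 2 in ph *.
(* Along [h], [J] changes by [t ^+ 2 * N + 2 * t * q]; this [t] minimizes it, with value
   [- q ^+ 2 / N]. *)
pose t := - q / N.
have := mu_le (x + t%:C *: h); move: hx.
rewrite /J -!rdotxx !(rdotDl, rdotDr, rdotZl, rdotZr) pD pZ.
rewrite (rdotC h x) [rdot h h]rdotxx -/N.
have tN : t * N = - q by rewrite /t divfK ?gt_eqF.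
move=> h1 h2.
have : - e <= t * (t * N) + 2 * t * q by rewrite /q; nra.
rewrite tN => h3.
have : - e * N <= (t * - q + 2 * t * q) * N by rewrite ler_pM2r.
by nra.
Qed.

(** By the parallelogram law, [J x + J y] exceeds twice [J] at the midpoint by half of
    [rnorm (x - y) ^+ 2], and [J] at the midpoint is at least [mu]. *)
Let almost_min_close x y e : J x <= mu + e -> J y <= mu + e ->
  rnorm (x - y) ^+ 2 <= 4 * e.
Proof.
move=> hx hy; have := mu_le ((2^-1)%:C *: (x + y)).
have := parallelogram x y; move: hx hy.
rewrite /J rnormZ rnorm_real pZ pD exprMn real_normK ?num_real //; lra.
Qed.

(** A minimizing sequence is Cauchy by [almost_min_close], and [almost_min_residual] makes the
    residual vanish at its limit. *)
Lemma real_riesz : exists z, forall h, p h = rdot z h.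
Proof.
have /choice[x hx] (n : nat) : exists y, J y < mu + n.+1%:R^-1.
  by apply: mu_approx; rewrite invr_gt0.
have tail e : 0 < e -> exists N, forall n, (N <= n)%N -> J (x n) <= mu + e.
  move=> e0; have [N hN] : exists N, N.+1%:R^-1 < e.
    by exists (Num.truncn e^-1); rewrite invf_plt ?posrE // truncnS_gt.
  exists N => n Nn; apply: le_trans (ltW (hx n)) _; rewrite lerD2l.
  by apply: le_trans (ltW hN); rewrite lef_pV2 ?posrE // ler_nat.
have [|z hz] := @hilbert_complete R H x.
  (* Then [4 * (e ^+ 2 / 8)] is half of [e ^+ 2], which leaves the strict inequality. *)
  move=> e e0; have e8 : 0 < e ^+ 2 / 8 by rewrite divr_gt0 ?exprn_gt0.
  have [N hN] := tail _ e8; exists N => m n Nm Nn.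
  rewrite -(ltr_pXn2r (n := 2)) ?nnegrE ?rnorm_ge0 ?(ltW e0) //.
  have := almost_min_close (hN _ Nm) (hN _ Nn); have := exprn_gt0 2 e0; lra.
exists z => h; apply/eqP; rewrite eq_sym -subr_eq0 -normr_le0.
set q := rdot z h - p h.
suff qd d : 0 < d -> `|q| <= d * (rnorm h + rnorm h).
  have [h0|h0] := eqVneq (rnorm h) 0; first by have := qd 1 ltr01; rewrite h0; lra.
  have ph : 0 < rnorm h by rewrite lt_def h0 rnorm_ge0.
  rewrite leNgt; apply/negP => q0.
  (* This [d] turns the estimate into [|q| <= |q| / 2], impossible for [q] nonzero. *)
  have := qd (`|q| / (4 * rnorm h)).
  rewrite divr_gt0 ?mulr_gt0 // => /(_ isT).
  have -> : `|q| / (4 * rnorm h) * (rnorm h + rnorm h) = `|q| / 2 by field.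
  lra.
move=> d0.
have [N1 h1] := hz _ d0.
have [N2 h2] := tail _ (exprn_gt0 2 d0).
(* Past [N1], [x n] is within [d] of the limit; past [N2] it minimizes [J] up to [d ^+ 2], so its
   residual is at most [d * rnorm h]. *)
pose n := maxn N1 N2.
have -> : q = rdot (z - x n) h + (rdot (x n) h - p h).
  by rewrite rdotBl /q; ring.
rewrite (le_trans (ler_normD _ _)) // mulrDr lerD //.
  apply: le_trans (norm_rdot_le _ _) _; rewrite ler_wpM2r ?rnorm_ge0 //.
  by rewrite ltW // h1 // leq_maxl.
rewrite -(ler_pXn2r (n := 2)) ?nnegrE ?mulr_ge0 ?rnorm_ge0 ?(ltW d0) //.
rewrite real_normK ?num_real // exprMn; apply: almost_min_residual.
by rewrite h2 // leq_maxr.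
Qed.

End RealRiesz.

(** Representing the real part is enough: by complex linearity the imaginary part of [phi h] is
    minus the real part of [phi ('i *: h)]. *)
Lemma riesz (phi : H -> R[i]) (C : R) :
  (forall x y, phi (x + y) = phi x + phi y) ->
  (forall a x, phi (a *: x) = a * phi x) ->
  (forall x, rnorm (phi x) <= C * rnorm x) ->
  exists z, forall h, phi h = inner H h z.
Proof.
move=> phiD phiZ phiC.
have [||x|z hz] := @real_riesz (fun x => complex.Re (phi x)) C.
- by move=> x y; rewrite phiD raddfD.
- by move=> t x; rewrite phiZ ReM_real.
- exact: le_trans (Re_le_rnorm _) (phiC x).
exists z => h; apply/eqP; rewrite eq_complex; apply/andP; split; apply/eqP.
  by rewrite hz rdotC.
have Im_i (w : R[i]) : complex.Im w = - complex.Re ('i * w).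
  by rewrite mulrC ReiNIm opprK.
by rewrite !Im_i -phiZ hz rdotC /rdot innerZl.
Qed.

(** Riesz applied for each [y] shows that the set in [adjoint] is inhabited, so [xget] does not fall
    back to its default. *)
Lemma adjointP (f : {linear H -> H}) : bounded_operator f ->
  forall x y, inner H (f x) y = inner H x (adjoint f y).
Proof.
move=> [M hM].
have ex y : exists z, forall x, inner H (f x) y = inner H x z.
  apply: (@riesz (fun x => inner H (f x) y) (M * rnorm y)) => [x x'|a x|x].
  - by rewrite linearD innerDl.
  - by rewrite linearZ innerZl.
  apply: le_trans (rnorm_inner_le _ _) _.
  by rewrite mulrAC ler_wpM2r ?rnorm_ge0.
have [g hg] := choice ex.
rewrite /adjoint; case: xgetP => [g' _ //|/(_ g) []].
by move=> x y; apply: hg.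
Qed.

End Riesz.

(** * Numerical radius, Crawford number, operator norm, self-adjoint maps *)

Section Radii.
Local Open Scope complex_scope.
Variables (R : realType) (H : hilbertSpace R).
Implicit Types (x y z : H) (f : H -> H) (K : R).

Lemma unit_vector x : x != 0 ->
  exists2 u, rnorm u = 1 & x = (rnorm x)%:C *: u.
Proof.
move=> x0; have n0 : rnorm x != 0 by rewrite gt_eqF ?rnorm_gt0.
exists ((rnorm x)^-1%:C *: x).
  by rewrite rnormZ rnorm_real ger0_norm ?invr_ge0 ?rnorm_ge0 // mulVf.
by rewrite scalerA -rmorphM /= divff // scale1r.
Qed.

Lemma sup_nonneg (S : set R) : (forall s, S s -> 0 <= s) -> 0 <= sup S.
Proof.
(* A set without supremum has [sup] equal to 0 by convention. *)
move=> S0; have [[[s Ss] bS]|/sup_out-> //] := pselect (has_sup S).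
by apply: le_trans (S0 _ Ss) _; apply: ub_le_sup.
Qed.

Lemma sup_le (S : set R) K : 0 <= K -> (forall s, S s -> s <= K) -> sup S <= K.
Proof.
move=> K0 SK; have [->|/set0P S0] := eqVneq S set0; first by rewrite sup0.
exact: ge_sup.
Qed.

Lemma numerical_radius_ge0 f : 0 <= numerical_radius f.
Proof. by apply: sup_nonneg => _ [x _ <-]; apply: rnorm_ge0. Qed.

Lemma numerical_radius_le f K : 0 <= K ->
  (forall x, rnorm x = 1 -> rnorm (inner H (f x) x) <= K) ->
  numerical_radius f <= K.
Proof. by move=> K0 fK; apply: sup_le => // _ [x /fK + <-]. Qed.

(** Boundedness makes the supremum genuine; the form is homogeneous of degree two in modulus, which
    carries the bound from unit vectors to all vectors. *)
Lemma rnorm_inner_radius (f : {linear H -> H}) x : bounded_operator f ->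
  rnorm (inner H (f x) x) <= numerical_radius f * rnorm x ^+ 2.
Proof.
move=> [M fM]; have [->|x0] := eqVneq x 0.
  by rewrite linear0r !rnorm0 expr0n mulr0.
have [u u1 xE] := unit_vector x0.
have -> : inner H (f x) x = (rnorm x ^+ 2)%:C * inner H (f u) u.
  have fx : f x = (rnorm x)%:C *: f u by rewrite {1}xE linearZ.
  rewrite fx {2}xE innerZl innerZr mulrA.
  by rewrite conj_Creal ?complex_real //= -rmorphM -expr2.
rewrite rnormM rnorm_real ger0_norm ?sqr_ge0 //.
rewrite mulrC ler_wpM2r ?sqr_ge0 //.
apply: ub_le_sup; last by exists u.
exists M => _ [y /= y1 <-]; apply: le_trans (rnorm_inner_le _ _) _.
by rewrite y1 mulr1 (le_trans (fM y)) // y1 mulr1.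
Qed.

Lemma crawford_ge0 f : 0 <= crawford f.
Proof.
rewrite /crawford; set S := (X in inf X).
have [->|/set0P S0] := eqVneq S set0; first by rewrite inf0.
by apply: lb_le_inf => // _ [x _ <-]; apply: rnorm_ge0.
Qed.

Lemma crawford_le f x : rnorm x = 1 -> crawford f <= rnorm (inner H (f x) x).
Proof.
move=> x1; apply: ge_inf; last by exists x.
by exists 0 => _ [y _ <-]; apply: rnorm_ge0.
Qed.

Lemma crawford_no_unit f : ~ (exists x, rnorm x = 1) -> crawford f = 0.
Proof.
move=> nx; rewrite /crawford; set S := (X in inf X).
suff -> : S = set0 by rewrite inf0.
by rewrite -subset0 => s [x x1 _]; apply: nx; exists x.
Qed.

Lemma opnorm_ge0 f : 0 <= opnorm f.
Proof. by apply: sup_nonneg => _ [x _ <-]; apply: rnorm_ge0. Qed.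

Lemma opnorm_le f K : 0 <= K ->
  (forall x, rnorm (f x) <= K * rnorm x) -> opnorm f <= K.
Proof.
move=> K0 fK; apply: sup_le => // _ [x /= x1 <-].
by apply: le_trans (fK x) _; rewrite ler_piMr.
Qed.

Lemma rnorm_opnorm f x : (forall t z, f (t *: z) = t *: f z) ->
  bounded_operator f -> rnorm (f x) <= opnorm f * rnorm x.
Proof.
move=> fZ [M fM]; have [->|x0] := eqVneq x 0.
  by rewrite -(scale0r (0 : H)) fZ !scale0r rnorm0 mulr0.
have [u u1 xE] := unit_vector x0.
rewrite {1}xE fZ rnormZ rnorm_real ger0_norm ?rnorm_ge0 // mulrC.
rewrite ler_wpM2r ?rnorm_ge0 //.
apply: ub_le_sup; last by exists u => //=; rewrite u1.
exists `|M| => _ [y /= y1 <-]; apply: le_trans (fM y) _.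
by apply: le_trans (ler_norm _) _; rewrite normrM ler_piMr // ger0_norm ?rnorm_ge0.
Qed.

Lemma rnorm_twice f x : (forall t z, f (t *: z) = t *: f z) ->
  bounded_operator f -> rnorm x = 1 -> rnorm (f (f x)) <= opnorm f ^+ 2.
Proof.
move=> fZ fB x1; apply: le_trans (rnorm_opnorm (f x) fZ fB) _.
rewrite expr2 ler_wpM2l ?opnorm_ge0 //.
by rewrite (le_trans (rnorm_opnorm x fZ fB)) // x1 mulr1.
Qed.

Definition selfadjoint f := forall x y, inner H (f x) y = inner H x (f y).

Lemma selfadjoint_rdot f : selfadjoint f -> forall x y, rdot (f x) y = rdot x (f y).
Proof. by move=> fS x y; rewrite /rdot fS. Qed.

(** [re_op] and [im_op] are bare functions; their linearity is recovered by testing against every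
    vector. *)
Lemma selfadjointD f : selfadjoint f -> {morph f : x y / x + y}.
Proof.
move=> fS x y; apply: inner_ext => h.
by rewrite innerDr -!fS innerDr.
Qed.

Lemma selfadjointZ f : selfadjoint f -> forall (a : R[i]) x, f (a *: x) = a *: f x.
Proof.
move=> fS a x; apply: inner_ext => h.
by rewrite innerZr -!fS innerZr.
Qed.

Lemma selfadjointN f : selfadjoint f -> {morph f : x / - x}.
Proof. by move=> fS x; rewrite -scaleN1r selfadjointZ // scaleN1r. Qed.

(* Polarization: compare the quadratic form at [x + t f x] and [x - t f x]. *)
Lemma selfadjoint_bound f K : selfadjoint f -> 0 <= K ->
  (forall x, `|rdot (f x) x| <= K * rnorm x ^+ 2) ->
  forall x, rnorm (f x) <= K * rnorm x.
Proof.
move=> fS K0 fK x.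
have key t : 2 * t * rnorm (f x) ^+ 2 <= K * (rnorm x ^+ 2 + t ^+ 2 * rnorm (f x) ^+ 2).
  set y := t%:C *: f x.
  have := parallelogram x y.
  rewrite [rnorm y]rnormZ rnorm_real exprMn real_normK ?num_real //.
  move=> /(congr1 ( *%R K)) pl.
  have := fK (x + y); have := fK (x - y).
  rewrite !ler_norml !(selfadjointD fS) (selfadjointN fS).
  rewrite !(rdotDl, rdotDr, rdotNl, rdotNr).
  have -> : rdot (f y) x = t * rnorm (f x) ^+ 2.
    by rewrite selfadjoint_rdot // rdotZl rdotxx.
  have -> : rdot (f x) y = t * rnorm (f x) ^+ 2 by rewrite rdotZr rdotxx.
  move=> /andP[h1 _] /andP[_ h2]; move: pl h1 h2; rewrite !mulrDr. lra.
rewrite -(ler_pXn2r (n := 2)) ?nnegrE ?mulr_ge0 ?rnorm_ge0 // exprMn.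
(* The best choice in [key] is [t = K^-1]; for [K = 0], [t = 1] already forces [f x] to vanish. *)
have [K00|K00] := eqVneq K 0.
  by have := key 1; rewrite K00; lra.
have pK : 0 < K by rewrite lt_def K00.
have e : K * (rnorm x ^+ 2 + K^-1 ^+ 2 * rnorm (f x) ^+ 2) =
    K * rnorm x ^+ 2 + K^-1 * rnorm (f x) ^+ 2 by field.
have : K^-1 * rnorm (f x) ^+ 2 <= K * rnorm x ^+ 2.
  by have := key K^-1; rewrite e; lra.
by rewrite -(ler_pM2l pK (K^-1 * _)) mulVKf // mulrA -expr2.
Qed.

End Radii.

(** * The Cartesian decomposition of an operator and of its square *)

Section Cartesian.
Local Open Scope complex_scope.
Variables (R : realType) (H : hilbertSpace R).
Implicit Types (x y z : H) (f g : H -> H).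

(* With [u = 1] and [u = - 'i%R] this is the real and the imaginary part. *)
Definition phase_part (u : R[i]) f g : H -> H :=
  fun x => 2^-1 *: (u *: f x + Num.conj u *: g x).

Lemma re_opE f : re_op f = phase_part 1 f (adjoint f).
Proof. by apply/funext => x; rewrite /re_op /phase_part rmorph1 !scale1r. Qed.

Lemma conjNi : Num.conj (- 'i%R : R[i]) = 'i%R.
Proof. by rewrite rmorphN /= conjCi opprK. Qed.

Lemma invi : ('i%R : R[i])^-1 = - 'i%R.
Proof. by rewrite invCi. Qed.

Lemma im_opE f : im_op f = phase_part (- 'i%R) f (adjoint f).
Proof.
apply/funext => x; rewrite /im_op /phase_part conjNi invfM invi -scalerA.
by rewrite scalerBr !scaleNr opprK.
Qed.

Section PhasePart.
Variables (f g : H -> H).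
Hypothesis fg : forall x y, inner H (f x) y = inner H x (g y).

Lemma adjoint_swap x y : inner H (g x) y = inner H x (f y).
Proof. by rewrite innerC -fg -innerC. Qed.

Lemma phase_part_selfadjoint u : selfadjoint (phase_part u f g).
Proof.
move=> x y; rewrite /phase_part innerZl innerZr innerDl innerDr !innerZl !innerZr.
by rewrite fg adjoint_swap conjCK fmorphV rmorph_nat [in RHS]addrC.
Qed.

Lemma rdot_phase_part u x :
  rdot (phase_part u f g x) x = complex.Re (u * inner H (f x) x).
Proof.
have -> : phase_part u f g x = (2^-1)%:C *: (u *: f x + Num.conj u *: g x).
  by rewrite /phase_part fmorphV rmorph_nat.
rewrite rdotZl rdotDl /rdot !innerZl adjoint_swap (innerC x (f x)) -rmorphM.
have -> (w : R[i]) : complex.Re (Num.conj w) = complex.Re w.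
  by apply: complexI; rewrite !complexRe Re_conj.
by field.
Qed.

(** The form of the phase part is [Re (u * inner H (f y) y)], at most the modulus of
    [inner H (f y) y]; for a self-adjoint map such a bound controls the norm. This is how the real
    and imaginary parts are bounded by the numerical radius. *)
Lemma rnorm_phase_part u x K : rnorm u = 1 -> 0 <= K ->
  (forall y, rnorm (inner H (f y) y) <= K * rnorm y ^+ 2) ->
  rnorm (phase_part u f g x) <= K * rnorm x.
Proof.
move=> u1 K0 fK; apply: selfadjoint_bound => //; first exact: phase_part_selfadjoint.
move=> y; rewrite rdot_phase_part.
have h : rnorm (u * inner H (f y) y) <= K * rnorm y ^+ 2 by rewrite rnormM u1 mul1r.
rewrite ler_norml; have := Re_le_rnorm (u * inner H (f y) y).
have := Re_le_rnorm (- (u * inner H (f y) y)); rewrite rnormN raddfN /=; lra.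
Qed.

End PhasePart.

Lemma adjoint_unique f g : (forall x y, inner H (f x) y = inner H x (g y)) ->
  adjoint f = g.
Proof.
move=> fg; rewrite /adjoint; case: xgetP => [g' _ fg'|/(_ g) /(_ fg)//].
by apply/funext => y; apply: inner_ext => h; rewrite -fg' fg.
Qed.

Section Operator.
Variable A : {linear H -> H}.
Hypothesis bA : bounded_operator A.
Let a := re_op A.
Let b := im_op A.
Let w := numerical_radius A.

Lemma re_op_selfadjoint : selfadjoint a.
Proof. by rewrite /a re_opE; apply: phase_part_selfadjoint; apply: adjointP. Qed.

Lemma im_op_selfadjoint : selfadjoint b.
Proof. by rewrite /b im_opE; apply: phase_part_selfadjoint; apply: adjointP. Qed.

Lemma rnorm_re_op x : rnorm (a x) <= w * rnorm x.
Proof.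
rewrite /a re_opE; apply: rnorm_phase_part; first exact: adjointP.
- by rewrite /rnorm normr1.
- exact: numerical_radius_ge0.
- by move=> y; apply: rnorm_inner_radius.
Qed.

Lemma rnorm_im_op x : rnorm (b x) <= w * rnorm x.
Proof.
rewrite /b im_opE; apply: rnorm_phase_part; first exact: adjointP.
- by rewrite rnormN rnormi.
- exact: numerical_radius_ge0.
- by move=> y; apply: rnorm_inner_radius.
Qed.

Lemma half_double x : (2^-1 : R[i]) *: (x + x) = x.
Proof.
rewrite -[x in x + _]scale1r -[x in _ + x]scale1r -scalerDl scalerA.
by rewrite mulVf ?scale1r.
Qed.

Lemma cartesian x : A x = a x + 'i%R *: b x.
Proof.
rewrite /a /b /re_op /im_op scalerA invfM mulrCA mulfV ?mulr1; last first.
  by rewrite neq0Ci.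
by rewrite -scalerDr addrACA subrr addr0 half_double.
Qed.

Lemma cartesian_adjoint x : adjoint A x = a x - 'i%R *: b x.
Proof.
rewrite /a /b /re_op /im_op scalerA invfM mulrCA mulfV ?mulr1; last first.
  by rewrite neq0Ci.
by rewrite -scalerBr opprB [A x + _]addrC addrACA subrr addr0 half_double.
Qed.

Lemma adjoint_square : adjoint (A \o A) = adjoint A \o adjoint A.
Proof. by apply: adjoint_unique => x y /=; rewrite !adjointP. Qed.

Lemma re_op_square_selfadjoint : selfadjoint (re_op (A \o A)).
Proof.
rewrite re_opE adjoint_square; apply: phase_part_selfadjoint => x y /=.
by rewrite !adjointP.
Qed.

(** Expanding the squares of [A] and of its adjoint in [a] and [b], the mixed terms have opposite
    signs and cancel in the average. *)
Lemma re_op_square x : re_op (A \o A) x = a (a x) - b (b x).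
Proof.
have aD := selfadjointD re_op_selfadjoint; have aZ := selfadjointZ re_op_selfadjoint.
have bD := selfadjointD im_op_selfadjoint; have bZ := selfadjointZ im_op_selfadjoint.
rewrite /re_op adjoint_square /=.
rewrite (cartesian x) (cartesian_adjoint x) cartesian cartesian_adjoint.
have aN := selfadjointN re_op_selfadjoint; have bN := selfadjointN im_op_selfadjoint.
clearbody a b.
rewrite !aD !bD aN bN !aZ !bZ.
have ii y : 'i%R *: ('i%R *: y) = - y :> H by rewrite scalerA -expr2 sqrCi scaleN1r.
rewrite (scalerDr _ (b (a x))) (scalerBr _ (b (a x))) ii opprK opprD.
set X := a (a x); set Y := b (b x); set p := 'i%R *: _; set q := 'i%R *: _.
rewrite addrACA [X + p + _]addrACA subrr addr0 [q - Y + _]addrACA subrr add0r.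
by rewrite addrACA half_double.
Qed.

End Operator.

End Cartesian.

(** * Fourth-power estimates and the commutator bounds *)

Section Bound.
Variables (R : realType) (H : hilbertSpace R) (A : {linear H -> H}).
Hypothesis bA : bounded_operator A.
Let a := re_op A.
Let b := im_op A.
Let w := numerical_radius A.
Let c := crawford (re_op (A \o A) \o re_op (A \o A)).

Lemma opnorm_re_op_le : opnorm a <= w.
Proof.
by apply: opnorm_le => [|x]; [exact: numerical_radius_ge0|exact: rnorm_re_op].
Qed.

Lemma opnorm_im_op_le : opnorm b <= w.
Proof.
by apply: opnorm_le => [|x]; [exact: numerical_radius_ge0|exact: rnorm_im_op].
Qed.

Lemma rnorm_re_op_twice (x : H) : rnorm x = 1 -> rnorm (a (a x)) <= opnorm a ^+ 2.
Proof.
apply: rnorm_twice; first exact: selfadjointZ (re_op_selfadjoint bA).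
by exists w => z; apply: rnorm_re_op.
Qed.

Lemma rnorm_im_op_twice (x : H) : rnorm x = 1 -> rnorm (b (b x)) <= opnorm b ^+ 2.
Proof.
apply: rnorm_twice; first exact: selfadjointZ (im_op_selfadjoint bA).
by exists w => z; apply: rnorm_im_op.
Qed.

(** For the self-adjoint [T = re_op (A \o A)], the form of [T \o T] at [x] is [rnorm (T x) ^+ 2]. *)
Lemma crawford_square_le (x : H) : rnorm x = 1 ->
  c <= rnorm (a (a x) - b (b x)) ^+ 2.
Proof.
move=> x1; apply: le_trans (crawford_le _ x1) _.
by rewrite /= re_op_square_selfadjoint // rnorm_inner_self re_op_square.
Qed.

Lemma cartesian_bound (x : H) : rnorm x = 1 ->
  (rnorm (a x) ^+ 2 + rnorm (b x) ^+ 2) ^+ 2 + c <=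
  2 * (opnorm a ^+ 4 + opnorm b ^+ 4).
Proof.
move=> x1; set s := rnorm (a x) ^+ 2 + rnorm (b x) ^+ 2.
have hs : s <= rnorm (a (a x) + b (b x)).
  rewrite -[leRHS]mulr1 -x1; apply: le_trans (rdot_le _ _).
  rewrite rdotDl (selfadjoint_rdot (re_op_selfadjoint bA)).
  by rewrite (selfadjoint_rdot (im_op_selfadjoint bA)) !rdotxx.
have s0 : 0 <= s by rewrite addr_ge0 ?sqr_ge0.
have hs2 : s ^+ 2 <= rnorm (a (a x) + b (b x)) ^+ 2.
  by rewrite ler_pXn2r ?nnegrE ?rnorm_ge0.
have ha : rnorm (a (a x)) ^+ 2 <= opnorm a ^+ 4.
  rewrite -[4%N]/(2 * 2)%N exprM ler_pXn2r ?nnegrE ?rnorm_ge0 ?sqr_ge0 //.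
  exact: rnorm_re_op_twice.
have hb : rnorm (b (b x)) ^+ 2 <= opnorm b ^+ 4.
  rewrite -[4%N]/(2 * 2)%N exprM ler_pXn2r ?nnegrE ?rnorm_ge0 ?sqr_ge0 //.
  exact: rnorm_im_op_twice.
have := crawford_square_le x1; have := parallelogram (a (a x)) (b (b x)).
lra.
Qed.

(** A sum of two reals is twice their maximum minus their distance, and both fourth powers are at
    most [w ^+ 4]. *)
Lemma opnorm4_le :
  2 * (opnorm a ^+ 4 + opnorm b ^+ 4) <=
  4 * (w ^+ 4 - `|opnorm a ^+ 4 - opnorm b ^+ 4| / 2).
Proof.
have ha : opnorm a ^+ 4 <= w ^+ 4.
  by rewrite ler_pXn2r ?nnegrE ?opnorm_ge0 ?numerical_radius_ge0 ?opnorm_re_op_le.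
have hb : opnorm b ^+ 4 <= w ^+ 4.
  by rewrite ler_pXn2r ?nnegrE ?opnorm_ge0 ?numerical_radius_ge0 ?opnorm_im_op_le.
by case: (ger0P (opnorm a ^+ 4 - opnorm b ^+ 4)); lra.
Qed.

Let m := w ^+ 4 - 4^-1 * c - `|opnorm a ^+ 4 - opnorm b ^+ 4| / 2.

Lemma cartesian_bound4 (x : H) : rnorm x = 1 ->
  (rnorm (a x) ^+ 2 + rnorm (b x) ^+ 2) ^+ 2 <= 4 * m.
Proof. move=> /cartesian_bound; have := opnorm4_le; rewrite /m; lra. Qed.

Lemma radicand_ge0 : 0 <= m.
Proof.
have [[x x1]|nx] := pselect (exists x : H, rnorm x = 1).
  have := cartesian_bound4 x1; have := sqr_ge0 (rnorm (a x) ^+ 2 + rnorm (b x) ^+ 2).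
  lra.
(* Without unit vectors the Crawford number is 0 by convention, and [opnorm4_le] alone gives the
   sign. *)
rewrite /m /c crawford_no_unit //; have := opnorm4_le.
have := exprn_ge0 4 (opnorm_ge0 a); have := exprn_ge0 4 (opnorm_ge0 b); lra.
Qed.

(** Comparing fourth powers removes both radicals: the right-hand side becomes [64 * m]. *)
Lemma rnorm_sum_adjoint (x : H) : rnorm x = 1 ->
  rnorm (A x) + rnorm (adjoint A x) <= 2 * Num.sqrt 2 * m `^ 4^-1.
Proof.
move=> x1; set r := m `^ 4^-1.
have r4 : r ^+ 4 = m.
  by rewrite -powR_mulrn ?powR_ge0 // -powRrM mulVf // powRr1 // radicand_ge0.
rewrite -(ler_pXn2r (n := 4)) ?nnegrE ?addr_ge0 ?rnorm_ge0 //; last first.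
  by rewrite !mulr_ge0 ?powR_ge0 ?sqrtr_ge0.
rewrite !exprMn r4 (_ : Num.sqrt 2 ^+ 4 = 4); last first.
  by rewrite -[4%N]/(2 * 2)%N exprM sqr_sqrtr // -natrX.
have pl := parallelogram (a x) ('i *: b x).
rewrite -cartesian // -cartesian_adjoint // [rnorm ('i *: _)]rnormZ rnormi mul1r in pl.
have := cartesian_bound4 x1.
set s := rnorm (a x) ^+ 2 + rnorm (b x) ^+ 2 in pl * => hs.
set p := rnorm (A x) in pl *; set q := rnorm (adjoint A x) in pl *.
(* The parallelogram law [pl] gives [p ^+ 2 + q ^+ 2 = 2 * s], and [(p + q) ^+ 2] is at most twice
   that sum. *)
have h2 : (p + q) ^+ 2 <= 4 * s by have := sqr_ge0 (p - q); nra.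
have : (p + q) ^+ 4 <= (4 * s) ^+ 2.
  rewrite -[4%N]/(2 * 2)%N exprM ler_pXn2r ?nnegrE ?sqr_ge0 //.
  by rewrite (le_trans _ h2) ?sqr_ge0.
rewrite exprMn; have -> : 2 ^+ 4 * 4 * m = 64 * m by ring.
lra.
Qed.

Variable B : {linear H -> H}.
Hypothesis bB : bounded_operator B.

(** Moving [A] across the inner product leaves [B x] against [adjoint A x], so both terms carry the
    factor [opnorm B]. Bounding the sum of moduli serves both signs. *)
Lemma rnorm_commutator_terms (x : H) : rnorm x = 1 ->
  rnorm (inner H (A (B x)) x) + rnorm (inner H (B (A x)) x) <=
  2 * Num.sqrt 2 * opnorm B * m `^ 4^-1.
Proof.
move=> x1.
have nB y : rnorm (B y) <= opnorm B * rnorm y.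
  by apply: rnorm_opnorm => // t z; rewrite linearZ.
have hAB : rnorm (inner H (A (B x)) x) <= opnorm B * rnorm (adjoint A x).
  rewrite adjointP //; apply: le_trans (rnorm_inner_le _ _) _.
  by rewrite ler_wpM2r ?rnorm_ge0 // (le_trans (nB x)) // x1 mulr1.
have hBA : rnorm (inner H (B (A x)) x) <= opnorm B * rnorm (A x).
  by apply: le_trans (rnorm_inner_le _ _) _; rewrite x1 mulr1.
rewrite mulrAC [leRHS]mulrC.
apply: le_trans (ler_wpM2l (opnorm_ge0 B) (rnorm_sum_adjoint x1)).
by rewrite mulrDr addrC lerD.
Qed.

End Bound.

Theorem corollary3p4 (R : realType) (H : hilbertSpace R)
    (A B : {linear H -> H})
    (hA : bounded_operator A) (hB : bounded_operator B) :
  let w := @numerical_radius R H in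
  let c := @crawford R H in
  let d : R := `|opnorm (re_op A) ^+ 4 - opnorm (im_op A) ^+ 4| / 2 in
  let m : R := w A ^+ 4 - 4^-1 * c (re_op (A \o A) \o re_op (A \o A)) - d in
  [/\ (* the fourth roots are roots of nonnegative reals *) 0 <= m,
      w ((A \o B) \+ (B \o A)) <= 2 * Num.sqrt 2 * opnorm B * m `^ (4^-1),
      w ((A \o B) \- (B \o A)) <= 2 * Num.sqrt 2 * opnorm B * m `^ (4^-1)
    & 2 * Num.sqrt 2 * opnorm B * m `^ (4^-1)
        <= 2 * Num.sqrt 2 * opnorm B * (w A ^+ 4 - d) `^ (4^-1)].
Proof.
move=> w c d m.
have m0 : 0 <= m := radicand_ge0 hA.
have C0 : 0 <= 2 * Num.sqrt 2 * opnorm B by rewrite !mulr_ge0 ?sqrtr_ge0 ?opnorm_ge0.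
split=> //.
- apply: numerical_radius_le => [|x x1]; first by rewrite mulr_ge0 ?powR_ge0.
  apply: le_trans (rnorm_commutator_terms hA hB x1).
  by rewrite /= innerDl rnormD.
- apply: numerical_radius_le => [|x x1]; first by rewrite mulr_ge0 ?powR_ge0.
  apply: le_trans (rnorm_commutator_terms hA hB x1).
  by rewrite /= innerDl innerNl (le_trans (rnormD _ _)) // rnormN.
(* Dropping the nonnegative Crawford term only enlarges the radicand. *)
- have md : m <= w A ^+ 4 - d.
    have := crawford_ge0 (re_op (A \o A) \o re_op (A \o A)).
    by rewrite /m /c; lra.
  rewrite ler_wpM2l //; apply: ge0_ler_powR; rewrite ?nnegrE ?invr_ge0 //.
  exact: le_trans md.
Qed.
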